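(* Let $X$ be a connected irreducible circulant of odd order and let $B(X)$ be its canonical double cover. Then $\mathrm{Aut}(B(X))\cong \mathrm{Aut}(X)\times \mathbb{Z}_2$.
   Context: All groups and graphs are finite; all graphs are simple and undirected. For a graph $X$, $V(X)$, $E(X)$ and $\mathrm{Aut}(X)$ denote its vertex set, edge set and automorphism group. For a group $G$ and an inverse-closed subset $S\subseteq G\setminus\{1_G\}$, the Cayley graph $\mathrm{Cay}(G,S)$ has vertex set $G$, with $x,y\in G$ adjacent if and only if $x^{-1}y\in S$. A circulant is a Cayley graph on a cyclic group; the order of a graph is its number of vertices. A graph is irreducible if distinct vertices have different neighbourhoods (sets of neighbours). The canonical double cover $B(X)$ of a graph $X$ is the direct product $X\times K_2$: it has vertex set $V(X)\times\mathbb{Z}_2$ and edge set $\{\{(x,0),(y,1)\} : \{x,y\}\in E(X)\}$, where both $\{(x,0),(y,1)\}$ and $\{(y,0),(x,1)\}$ are edges for each edge $\{x,y\}$ of $X$. *)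

(* Defs.v *)
From mathcomp Require Import all_boot all_order all_algebra all_fingroup all_solvable.

Set Implicit Arguments.
Unset Strict Implicit.
Unset Printing Implicit Defensive.

Import GroupScope.

Record sgraph := SGraph {
  vertex :> finType;
  adj : rel vertex;
  adj_sym : symmetric adj;
  adj_irr : irreflexive adj
}.

Definition graph_iso (X Y : sgraph) : Prop :=
  exists2 f : X -> Y, bijective f & {mono f : x y / adj x y}.

Definition connected (X : sgraph) : Prop :=
  forall x y : X, connect (@adj X) x y.

Definition nbhd (X : sgraph) (x : X) : {set X} := [set y | adj x y].

Definition irreducible (X : sgraph) : Prop := injective (@nbhd X).

Definition gaut (X : sgraph) : {set {perm X}} :=
  [set s : {perm X} | [forall x, forall y, adj (s x) (s y) == adj x y]].

Lemma gautP (X : sgraph) (s : {perm X}) :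
  reflect {mono s : x y / adj x y} (s \in gaut X).
Proof.
rewrite inE; apply: (iffP forallP) => [h x y | h x].
  exact/eqP/(forallP (h x)).
by apply/forallP => y; rewrite h.
Qed.

Lemma gaut_group_set (X : sgraph) : group_set (gaut X).
Proof.
apply/group_setP; split=> [|s t /gautP hs /gautP ht].
  by apply/gautP => x y; rewrite !perm1.
by apply/gautP => x y; rewrite !permM ht hs.
Qed.

Canonical gaut_group (X : sgraph) : {group {perm X}} :=
  Group (gaut_group_set X).

Section Cayley.

Variables (gT : finGroupType) (S : {set gT}).
Hypotheses (invS : {in S, forall s, s^-1 \in S}) (S1 : 1 \notin S).

Definition cayley_rel : rel gT := fun x y => x^-1 * y \in S.

Lemma cayley_sym : symmetric cayley_rel.
Proof.
have sub x y : cayley_rel x y -> cayley_rel y x.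
  by move=> /invS; rewrite /cayley_rel invMg invgK.
by move=> x y; apply/idP/idP; apply: sub.
Qed.

Lemma cayley_irr : irreflexive cayley_rel.
Proof. by move=> x; rewrite /cayley_rel mulVg; apply: negbTE. Qed.

Definition cayley : sgraph := SGraph cayley_sym cayley_irr.

End Cayley.

(* Being a circulant is taken up to graph isomorphism, so that it is a property
   of an arbitrary graph. *)
Definition circulant (X : sgraph) : Prop :=
  exists (gT : finGroupType) (S : {set gT})
         (invS : {in S, forall s, s^-1 \in S}) (S1 : 1 \notin S),
    cyclic [set: gT] /\ graph_iso X (cayley invS S1).

Section DirectProduct.

Variables X Y : sgraph.

Definition dprod_rel : rel (X * Y)%type :=
  fun p q => adj p.1 q.1 && adj p.2 q.2.

Lemma dprod_sym : symmetric dprod_rel.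
Proof. by move=> p q; rewrite /dprod_rel adj_sym (adj_sym p.2). Qed.

Lemma dprod_irr : irreflexive dprod_rel.
Proof. by move=> p; rewrite /dprod_rel adj_irr. Qed.

Definition direct_product : sgraph := SGraph dprod_sym dprod_irr.

End DirectProduct.

Definition K2_rel : rel 'Z_2 := fun i j => i != j.

Lemma K2_sym : symmetric K2_rel.
Proof. by move=> i j; rewrite /K2_rel eq_sym. Qed.

Lemma K2_irr : irreflexive K2_rel.
Proof. by move=> i; rewrite /K2_rel eqxx. Qed.

Definition K2 : sgraph := SGraph K2_sym K2_irr.

Definition double_cover (X : sgraph) : sgraph := direct_product X K2.

(* The edges of the double cover are exactly the {(x, 0), (y, 1)} with x and y
   adjacent. *)
Lemma double_cover_adjE (X : sgraph) (p q : double_cover X) :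
  adj p q <->
  exists x y : X, adj x y /\
    ((p = (x, 0%R : 'Z_2) /\ q = (y, 1%R : 'Z_2)) \/
     (p = (y, 1%R : 'Z_2) /\ q = (x, 0%R : 'Z_2))).
Proof.
have Z2 (i : 'Z_2) : i = 0%R \/ i = 1%R.
  by case: i => [[|[|//]] h]; [left|right]; apply: val_inj.
split=> [|[x [y [xy [[-> ->]|[-> ->]]]]]]; last first.
- by rewrite /adj /= /dprod_rel /= adj_sym xy.
- by rewrite /adj /= /dprod_rel /= xy.
case: p q => [x i] [y j] /andP[/= xy].
case: (Z2 i) (Z2 j) => -> [] -> //= _; first by exists x, y; split; last left.
by exists y, x; split; [rewrite adj_sym | right].
Qed.

(* Main.v *)
Require Import Defs.
From mathcomp Require Import all_boot all_order all_algebra all_fingroup all_solvable.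

(** Write [odd_common e x y] when [x] and [y] have an odd number of common
    neighbours for [e]; every automorphism of [e] preserves this relation. In
    Cay(G, S) with [G] abelian of odd order, the pairs (s, t) in S x S with
    s t = g are exchanged by (s, t) |-> (t, s), so their number is odd exactly
    when the square root of [g] lies in [S]: the relation is Cay(G, S^2), where
    S^2 is the set of squares. Squaring permutes [G], so some iterate gives back
    Cay(G, S). On the double cover the same iterate gives two disjoint copies
    of [X], one on each layer, and these are therefore preserved by Aut(B(X)).
    As [X] is connected, an automorphism of B(X) permutes the two layers, so it
    is given by two automorphisms [a] and [b] of [X]; since it also preserves
    B(X), the neighbourhoods of [a x] and [b x] coincide, and irreducibility
    gives [a = b]. *)

Set Implicit Arguments.
Unset Strict Implicit.
Unset Printing Implicit Defensive.

Import GroupScope.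

(** * Parity of common neighbour counts *)

Lemma odd_card_involution (T : finType) (f : T -> T) (A : {set T}) :
  involutive f -> {in A, forall x, f x \in A} ->
  odd #|A| = odd #|[set x in A | f x == x]|.
Proof.
move=> fK; have [n] := ubnP #|A|; elim: n A => // n IHn A leAn fA.
(* A moved point [x] is deleted together with its partner [f x]: this keeps the parity, the
   stability under [f] and the set of fixed points. *)
case: (pickP [pred x in A | f x != x]) => [x /andP[/= xA fx] | fix_all].
  have fxA : f x \in A :\ x by rewrite !inE fx fA.
  have cardA : #|A| = #|A :\ x :\ f x|.+2.
    by rewrite (cardsD1 x) xA (cardsD1 (f x)) fxA.
  rewrite cardA /= negbK IHn; last 2 first.
  - by apply: leq_trans (leAn : _ <= n); rewrite cardA.
  - move=> y; rewrite !inE => /and3P[yfx yx yA].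
    by rewrite fA // (inj_eq (inv_inj fK)) yx (inv_eq fK) yfx.
  congr (odd _); apply: eq_card => y; rewrite !inE.
  have [->|_] := eqVneq y (f x).
    by rewrite fK [x == _]eq_sym (negbTE fx) !andbF.
  by have [->|//] := eqVneq y x; rewrite (negbTE fx) !andbF.
congr (odd _); apply: eq_card => x; rewrite !inE.
by have := fix_all x; rewrite /=; case: (x \in A) => //= /negbFE ->.
Qed.

Definition odd_common (T : finType) (e : rel T) : rel T :=
  fun x y => odd #|[set z | e x z && e z y]|.

Lemma eq_odd_common (T : finType) (e e' : rel T) :
  e =2 e' -> odd_common e =2 odd_common e'.
Proof.
by move=> ee x y; congr (odd _); apply: eq_card => z; rewrite !inE !ee.
Qed.

Lemma odd_common_mono (T U : finType) (e : rel T) (e' : rel U) (f : T -> U) :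
  bijective f -> {mono f : x y / e x y >-> e' x y} ->
  {mono f : x y / odd_common e x y >-> odd_common e' x y}.
Proof.
move=> f_bij fe x y; congr (odd _).
rewrite -(card_imset _ (bij_inj f_bij)); apply: eq_card => z.
have [g fK gK] := f_bij; rewrite -[z]gK (mem_imset _ _ (bij_inj f_bij)).
by rewrite !inE !fe.
Qed.

Lemma iter_odd_common_mono (T U : finType) (e : rel T) (e' : rel U) (f : T -> U)
    (m : nat) :
  bijective f -> {mono f : x y / e x y >-> e' x y} ->
  {mono f : x y /
    iter m (@odd_common T) e x y >-> iter m (@odd_common U) e' x y}.
Proof.
by move=> f_bij fe; elim: m => //= m; apply: odd_common_mono.
Qed.

(** * Cayley graphs on abelian groups of odd order *)

Section OddAbelianCayley.

Variable gT : finGroupType.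
Hypotheses (abelT : abelian [set: gT]) (oddT : odd #|[set: gT]|).

(** The inverse of 2 modulo the odd group order, so that raising to the power [h] extracts the
    unique square root. *)
Let h := #|[set: gT]|.+1./2.

Lemma half_exp_sqrt (g x : gT) : (x * x == g) = (x == g ^+ h).
Proof.
have h2 (y : gT) : y ^+ (h + h) = y.
  rewrite addnn even_halfK /= ?oddT // expgS.
  by rewrite (expg_cardG (in_setT y)) mulg1.
by apply/eqP/eqP => [<- | ->]; rewrite -?expgD // -expg2 -expgM mul2n -addnn h2.
Qed.

Lemma odd_common_cayley (S : {set gT}) :
  odd_common (cayley_rel S) =2 cayley_rel [set g | g ^+ h \in S].
Proof.
move=> x y; rewrite /odd_common.
have mulC (a b : gT) : a * b = b * a by apply: (centsP abelT); rewrite inE.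
(* Common neighbours are the [x * s] with [s] and [f s] in [S]; commutativity makes [f] an
   involution, and its only fixed point is the square root of [g]. *)
pose g := x^-1 * y; pose f s := s^-1 * g.
have fK : involutive f by move=> s; rewrite /f invMg invgK [_ * s]mulC mulgVK.
pose A := [set s in S | f s \in S].
have -> : #|[set z | cayley_rel S x z && cayley_rel S z y]| = #|A|.
  rewrite -[RHS](card_imset _ (mulgI x)); apply: eq_card => z.
  rewrite -[z](mulVKg x) (mem_imset _ _ (mulgI x)) !inE /cayley_rel mulKg.
  by rewrite invMg /f /g mulgA.
rewrite (odd_card_involution fK) => [|s]; last by rewrite !inE fK andbC.
have fixE s : (f s == s) = (s == g ^+ h).
  by rewrite -half_exp_sqrt -(inj_eq (mulgI s)) mulVKg eq_sym.
rewrite [RHS]inE -/g; have [gS|gS] := boolP (g ^+ h \in S).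
  suff -> : [set s in A | f s == s] = [set g ^+ h] by rewrite cards1.
  apply/setP => s; rewrite !inE fixE; case: eqP => [->|]; rewrite ?andbF //.
  by have /eqP -> : f (g ^+ h) == g ^+ h; rewrite ?fixE ?gS.
suff -> : [set s in A | f s == s] = set0 by rewrite cards0.
apply/setP => s; rewrite !inE fixE; case: eqP => [->|]; rewrite ?andbF //.
by rewrite (negbTE gS).
Qed.

Lemma iter_odd_common_cayley (S : {set gT}) (m : nat) :
  iter m (@odd_common gT) (cayley_rel S)
    =2 cayley_rel [set g | g ^+ (h ^ m) \in S].
Proof.
elim: m => [|m IHm] x y /=; first by rewrite /cayley_rel inE.
rewrite (eq_odd_common IHm) odd_common_cayley /cayley_rel !inE.
by rewrite -expgM -expnS.
Qed.

(** Since 2h is the group order plus one, [h] is coprime to the order, and Euler's theorem brings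
    [h] to 1 after totient many steps. At least one step is required because the double cover splits
    into layers only from the first step on. *)
Lemma odd_common_cayley_period (S : {set gT}) :
  exists m, iter m.+1 (@odd_common gT) (cayley_rel S) =2 cayley_rel S.
Proof.
have n_gt0 : 0 < #|[set: gT]| by apply: cardG_gt0.
exists (totient #|[set: gT]|).-1 => x y.
rewrite prednK ?totient_gt0 // iter_odd_common_cayley /cayley_rel inE.
have co : coprime h #|[set: gT]|.
  have: coprime (h * 2) #|[set: gT]|.
    by rewrite muln2 even_halfK /= ?oddT // coprimeSn.
  by rewrite coprimeMl => /andP[].
suff -> : (x^-1 * y) ^+ (h ^ totient #|[set: gT]|) = x^-1 * y by [].
rewrite -[RHS]expg1; apply/eqP; rewrite eq_expg_mod_order.
have dvd := order_dvdG (in_setT (x^-1 * y)).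
by rewrite -(modn_dvdm _ dvd) Euler_exp_totient // modn_dvdm.
Qed.

End OddAbelianCayley.

Lemma odd_circulant_odd_common_period (X : sgraph) :
  circulant X -> odd #|X| ->
  exists m, iter m.+1 (@odd_common X) (@adj X) =2 @adj X.
Proof.
move=> [gT [S [invS [S1 [cycT [f f_bij f_mono]]]]]] oddX.
have oddT : odd #|[set: gT]| by rewrite cardsT -(bij_eq_card f_bij).
have [m per] := odd_common_cayley_period (cyclic_abelian cycT) oddT S.
exists m => x y; rewrite -(iter_odd_common_mono m.+1 f_bij f_mono).
by rewrite [LHS]per -[RHS]f_mono.
Qed.

(** * Layers of the double cover *)

Definition layered (T : finType) (e : rel T) : rel (T * 'Z_2) :=
  fun p q => e p.1 q.1 && (p.2 == q.2).

Lemma Z2_cases (i : 'Z_2) : i = 0%R \/ i = 1%R.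
Proof. by case: i => [[|[|//]] ?]; [left | right]; apply: val_inj. Qed.

Lemma Z2_neq (i j k : 'Z_2) : i != j -> j != k -> i = k.
Proof. by case: (Z2_cases i) (Z2_cases j) (Z2_cases k) => -> [] -> [] ->. Qed.

Lemma odd_common_layered (T : finType) (e : rel T) :
  odd_common (layered e) =2 layered (odd_common e).
Proof.
move=> [x i] [y j]; rewrite /odd_common /layered /=.
have [<-|ij] := eqVneq i j; last first.
  rewrite andbF; set A := [set z | _]; suff -> : A = set0 by rewrite cards0.
  apply/setP => -[z k]; rewrite !inE /=; apply/negP.
  by case/andP => /andP[_ /eqP ik] /andP[_ /eqP kj]; rewrite ik kj eqxx in ij.
have injp : injective (fun z : T => (z, i)) by move=> ? ? [].
rewrite andbT -(card_imset _ injp); congr (odd _); apply: eq_card => -[z k].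
rewrite !inE /=; apply/andP/imsetP => [[/andP[xz /eqP <-] /andP[zy _]]|].
  by exists z; rewrite // inE xz.
by case=> w; rewrite inE => /andP[xw wy] [-> ->]; rewrite xw wy eqxx.
Qed.

(** Every edge changes layer, so vertices with a common neighbour share a layer [i], and their
    common neighbours all lie in layer [i + 1]. *)
Lemma odd_common_double_cover (X : sgraph) :
  odd_common (@adj (double_cover X)) =2 layered (odd_common (@adj X)).
Proof.
move=> [x i] [y j]; rewrite /odd_common /layered /=.
have [<-|ij] := eqVneq i j; last first.
  rewrite andbF; set A := [set z | _]; suff -> : A = set0 by rewrite cards0.
  apply/setP => -[z k]; rewrite !inE /=; apply/negP.
  by case/andP=> /andP[_ ik] /andP[_ kj]; case/eqP: ij; apply: Z2_neq ik kj.
have injp : injective (fun z : X => (z, (i + 1)%R)) by move=> ? ? [].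
rewrite andbT -(card_imset _ injp); congr (odd _); apply: eq_card => -[z k].
rewrite !inE /=; apply/andP/imsetP => [[/andP[/= xz ik] /andP[/= zy _]]|].
  exists z; rewrite ?inE ?xz //; congr (_, _).
  by apply: (@Z2_neq _ i); [rewrite eq_sym | case: (Z2_cases i) => ->].
case=> w; rewrite inE => /andP[xw wy] [-> ->].
rewrite /adj /= /dprod_rel /= xw wy.
by case: (Z2_cases i) => ->.
Qed.

Lemma iter_odd_common_double_cover (X : sgraph) (m : nat) :
  iter m.+1 (@odd_common _) (@adj (double_cover X))
    =2 layered (iter m.+1 (@odd_common _) (@adj X)).
Proof.
elim: m => [|m IHm] p q; first exact: odd_common_double_cover.
by rewrite iterS (eq_odd_common IHm) odd_common_layered.
Qed.

Lemma double_cover_aut_layered (X : sgraph) (s : {perm double_cover X}) :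
  circulant X -> odd #|X| -> s \in gaut (double_cover X) ->
  {mono s : p q / layered (@adj X) p q}.
Proof.
move=> circX oddX /gautP s_mono p q.
have [m per] := odd_circulant_odd_common_period circX oddX.
have layE (u v : double_cover X) : layered (@adj X) u v =
    iter m.+1 (@odd_common _) (@adj (double_cover X)) u v.
  by rewrite iter_odd_common_double_cover /layered per.
have s_bij : bijective s by exists s^-1; [apply: permK | apply: permKV].
by rewrite !layE (iter_odd_common_mono _ s_bij s_mono).
Qed.

(** * Automorphisms lifted from the base graph and a layer shift *)

Section LiftedAutomorphisms.

Variable X : sgraph.

Definition lift_fun (a : {perm X} * 'Z_2) (p : double_cover X) :
    double_cover X :=
  (a.1 p.1, (p.2 + a.2)%R).

Lemma lift_fun_inj a : injective (lift_fun a).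
Proof.
move=> [x i] [y j] axy; congr pair; first exact: perm_inj (congr1 fst axy).
exact: GRing.addIr (congr1 snd axy).
Qed.

Definition lift_perm a : {perm double_cover X} := perm (@lift_fun_inj a).

Lemma lift_permM : {morph lift_perm : a b / a * b}.
Proof.
move=> [a i] [b j]; apply/permP => -[x k].
by rewrite permM !permE /lift_fun /= permM GRing.addrA.
Qed.

(** The vertex [x0] serves to read off the shift: over an empty graph both shifts give the same
    permutation. *)
Lemma lift_perm_inj (x0 : X) : injective lift_perm.
Proof.
move=> [a i] [b j] /permP eq_ab.
have eqx x : (a x, i) = (b x, j).
  by have := eq_ab (x, 0%R); rewrite !permE /lift_fun /= !GRing.add0r.
by congr (_, _); [apply/permP => x|]; [case: (eqx x) | case: (eqx x0)].
Qed.

Canonical lift_morphism :=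
  @Morphism _ _ (setX (gaut X) [set: 'Z_2]) lift_perm
    (fun a b _ _ => lift_permM a b).

Lemma lift_perm_gaut a :
  a.1 \in gaut X -> lift_perm a \in gaut (double_cover X).
Proof.
move=> /gautP a_mono; apply/gautP => -[x i] [y j].
rewrite !permE /adj /= /dprod_rel /= a_mono; congr (_ && _).
by rewrite /adj /= /K2_rel (inj_eq (@GRing.addIr _ _)).
Qed.

End LiftedAutomorphisms.

Lemma double_cover_aut_lift (X : sgraph) (s : {perm double_cover X}) :
  connected X -> irreducible X -> X ->
  s \in gaut (double_cover X) -> {mono s : p q / layered (@adj X) p q} ->
  exists2 a, a.1 \in gaut X & s = lift_perm a.
Proof.
move=> connX irrX x0 /gautP s_mono s_lay.
(* Each step of a path in [X] lifts to a [layered] edge, whose image stays inside one layer. *)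
have layer x y i : (s (x, i)).2 = (s (y, i)).2.
  have /connectP[p] := connX x y.
  elim: p x => [|z p IHp] x /=; first by move=> _ ->.
  case/andP=> xz zp yE; rewrite -(IHp z) //; apply/eqP.
  have : layered (@adj X) (s (x, i)) (s (z, i)).
    by rewrite s_lay /layered /= xz eqxx.
  by case/andP.
pose l i := (s (x0, i)).2.
have sE x i : s (x, i) = ((s (x, i)).1, l i).
  by rewrite /l (layer x0 x); case: (s _).
(* Otherwise [s] would miss the other layer, against surjectivity. *)
have l01 : l 0%R != l 1%R.
  apply/eqP => l01.
  have lE i : l i = l 0%R by case: (Z2_cases i) => ->.
  have := sE (s^-1 (x0, (l 0%R + 1)%R)).1 (s^-1 (x0, (l 0%R + 1)%R)).2.
  rewrite -surjective_pairing permKV => /(congr1 snd) /=; rewrite lE.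
  by case: (Z2_cases (l 0%R)) => ->.
have lE i : l i = (i + l 0%R)%R.
  case: (Z2_cases i) => ->; first by rewrite GRing.add0r.
  move: l01; case: (Z2_cases (l 0%R)) (Z2_cases (l 1%R)) => -> [] -> // _;
    exact: val_inj.
have f_inj i : injective (fun x => (s (x, i)).1).
  move=> x y /= exy; have : s (x, i) = s (y, i) by rewrite (sE x) (sE y) exy.
  by move/perm_inj => [].
have f_mono i : {mono (fun x => (s (x, i)).1) : x y / adj x y}.
  move=> x y /=; have := s_lay (x, i) (y, i).
  by rewrite (sE x) (sE y) /layered /= !eqxx !andbT.
have f01_mono x y : adj (s (x, 0%R)).1 (s (y, 1%R)).1 = adj x y.
  have := s_mono (x, 0%R) (y, 1%R).
  by rewrite (sE x) (sE y) /adj /= /dprod_rel /= /adj /= /K2_rel l01 !andbT.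
(* Writing [y] as the image of [g y] under the map on layer 1, both adjacencies to [y] reduce to
   that of [x] and [g y]; irreducibility concludes. *)
have f01 x : (s (x, 0%R)).1 = (s (x, 1%R)).1.
  apply: irrX; apply/setP => y; rewrite !inE.
  have [g _ gK] := injF_bij (f_inj 1%R).
  by rewrite -(gK y) f01_mono (f_mono 1%R).
exists (perm (f_inj 0%R), l 0%R) => /=.
  by apply/gautP => x y; rewrite !permE f_mono.
apply/permP => -[x i]; rewrite permE /lift_fun /= permE sE lE.
by case: (Z2_cases i) => -> //; rewrite f01.
Qed.

Theorem theorem1p2 (X : sgraph) (hconn : connected X) (hirr : irreducible X)
    (hcirc : circulant X) (hodd : odd #|X|) :
  gaut (double_cover X) \isog setX (gaut X) [set: 'Z_2].
Proof.
have [x0 _] : exists x0 : X, x0 \in X by apply/card_gt0P; apply: odd_gt0.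
rewrite isog_sym; apply/isogP; exists (lift_morphism X).
  by apply/injmP => a b _ _; apply: lift_perm_inj x0 a b.
apply/setP => s; rewrite morphimEdom; apply/imsetP/idP => [[a aG ->] | sG].
  by apply: lift_perm_gaut; move: aG; rewrite inE => /andP[].
have s_lay := double_cover_aut_layered hcirc hodd sG.
have [[a i] /= aG ->] := double_cover_aut_lift hconn hirr x0 sG s_lay.
by exists (a, i); rewrite // in_setX aG inE.
Qed.
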